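(* Let $G$ be a finite group and $p$ a prime. (1) If $G$ is a $p$-group then every synthetic building for $G$ at the prime $p$ is $G$-equivariantly contractible. (2) $O_p(G)\neq 1$ if and only if every minimal synthetic building for $G$ at the prime $p$ is $G$-equivariantly contractible.
   Context: A $G$-simplicial complex is a finite simplicial complex $\Delta$ with a simplicial action of the finite group $G$ such that the setwise stabilizer of each simplex fixes that simplex pointwise. For $H\le G$, $\Delta^H$ denotes the fixed point subcomplex. $O_p(G)$ is the largest normal $p$-subgroup of $G$. A $G$-simplicial complex $\Delta$ is a synthetic building for $G$ at the prime $p$ if (1) $\Delta^P$ is $N_G(P)$-equivariantly contractible for every non-identity $p$-subgroup $P\le G$, and (2) the stabilizer of every simplex has order divisible by $p$. A synthetic building is minimal if it has no proper $G$-invariant subcomplex that is also a synthetic building for $G$ at $p$.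
   Formalization: In (1) the group G is assumed non-trivial: for G = 1 the empty complex is a synthetic building (both conditions hold vacuously) but is not contractible; excluding the empty complex instead would make (2) fail when p does not divide |G|. *)

(* Defs.v *)
From HB Require Import structures.
From mathcomp Require Import all_boot all_order all_algebra all_fingroup.
From mathcomp Require Import pgroup.
From mathcomp Require Import boolp classical_sets reals topology normedtype.
Import Order.TTheory GRing.Theory Num.Theory.
Import numFieldNormedType.Exports.

Set Implicit Arguments.
Unset Strict Implicit.
Unset Printing Implicit Defensive.

Local Open Scope group_scope.

(* [V] is only an ambient set of vertices: the vertices of [D] are the [v] with
   [[set v] \in D].  So a complex on [V] and its subcomplexes live in the same
   type, and the empty complex is allowed. *)
Definition simplicial_complex (V : finType) (D : {set {set V}}) : Prop :=
  finset.set0 \notin D /\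
  forall s t : {set V},
    s \in D -> t \subset s -> t != finset.set0 -> t \in D.

(* As everywhere in MathComp, groups act on the right. *)
Definition G_simplicial_complex (gT : finGroupType) (G : {group gT})
    (V : finType) (to : action G V) (D : {set {set V}}) : Prop :=
  [/\ simplicial_complex D,
      forall (g : gT) (s : {set V}),
        g \in G -> s \in D -> [set to v g | v in s]%SET \in D
    & forall s : {set V}, s \in D -> 'N_G(s | to) \subset 'C_G(s | to)].

Definition fixed_subcomplex (gT : finGroupType) (G : {group gT})
    (V : finType) (to : action G V) (D : {set {set V}}) (H : {set gT}) :
    {set {set V}} :=
  [set s in D | s \subset 'Fix_to(H)]%SET.

Local Open Scope classical_set_scope.
Local Open Scope ring_scope.

(* Geometric realization by barycentric coordinates; [V] is finite, so the
   product topology of [{ptws V -> R}] is the Euclidean one. *)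
Definition realization (R : realType) (V : finType) (D : {set {set V}}) :
    set {ptws V -> R} :=
  [set x | [/\ forall v, 0 <= x v, \sum_v x v = 1
             & [set v | x v != 0]%SET \in D]].

(* The affine extension of the action on vertices: the coordinate of [x] at [v]
   becomes the coordinate of the image of [x] at [to v g]. *)
Definition realization_act (R : realType) (gT : finGroupType) (G : {group gT})
    (V : finType) (to : action G V) (x : {ptws V -> R}) (g : gT) :
    {ptws V -> R} :=
  fun v => x (to v g^-1%g).

(* The [K]-space [X] is [K]-homotopy equivalent to a point, that is, its
   identity map is [K]-homotopic to the constant map at a [K]-fixed point. *)
Definition equivariantly_contractible (R : realType) (T : topologicalType)
    (gT : finGroupType) (act : T -> gT -> T) (K : {set gT}) (X : set T) :
    Prop :=
  exists x0 : T, exists h : R * T -> T,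
    [/\ X x0 /\ (forall g, g \in K -> act x0 g = x0),
        {within `[0, 1]%classic `*` X, continuous h},
        forall (t : R) (x : T), 0 <= t <= 1 -> X x -> X (h (t, x)),
        forall x : T, X x -> h (0, x) = x /\ h (1, x) = x0
      & forall (t : R) (x : T) (g : gT), 0 <= t <= 1 -> X x -> g \in K ->
          h (t, act x g) = act (h (t, x)) g].

Definition contractible_complex (R : realType) (gT : finGroupType)
    (G : {group gT}) (V : finType) (to : action G V) (K : {set gT})
    (D : {set {set V}}) : Prop :=
  @equivariantly_contractible R {ptws V -> R} gT
    (@realization_act R gT G V to) K (@realization R V D).

(* If [p] does not divide [#|G|] the empty complex is the only synthetic building,
   and it is not contractible. *)
Definition synthetic_building (R : realType) (gT : finGroupType)
    (G : {group gT}) (p : nat) (V : finType) (to : action G V)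
    (D : {set {set V}}) : Prop :=
  [/\ G_simplicial_complex to D,
      forall P : {group gT}, P \subset G -> (p.-group P)%g -> P :!=: 1%g ->
        contractible_complex R to ('N_G(P))%g (fixed_subcomplex to D P)
    & forall s : {set V}, s \in D -> (p %| #|('N_G(s | to))%g|)%N].

Definition minimal_synthetic_building (R : realType) (gT : finGroupType)
    (G : {group gT}) (p : nat) (V : finType) (to : action G V)
    (D : {set {set V}}) : Prop :=
  synthetic_building R p to D /\
  forall D' : {set {set V}},
    D' \subset D -> synthetic_building R p to D' -> D' = D.

(* Main.v *)
(** Part (1) rests on an equivariant Whitehead argument.  If [G] is a p-group, the
    stabilizer [P] of a simplex is a nontrivial p-subgroup, so the fixed complex of
    [P] is contractible, and the fixed complex of [G] provides a [G]-fixed point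
    [x0].  A [G]-homotopy from the identity to [x0] is built one skeleton at a time:
    over a simplex [s] with stabilizer [P] the prism [`[0, 1] * s] has to be mapped to
    the fixed points of [P], the map being given on the boundary, and it is filled by
    coning off.  As a stabilizer fixes its simplex pointwise, one simplex per orbit
    can be treated freely and the result transported along the action.

    For part (2), if [Q] is the nontrivial group [O_p(G)], then the fixed complex of
    [Q] is again a synthetic building: the fixed points of [P] in it are those of [PQ].
    A minimal building therefore equals it, and it is contractible equivariantly for
    [N_G(Q) = G].  Conversely, the order complex of the nontrivial p-subgroups of [G] is
    a synthetic building, since [P <= PQ >= Q] contracts the fixed points of [Q].  A
    minimal building inside it that is [G]-contractible has a [G]-fixed point, hence a
    [G]-fixed vertex, which is a nontrivial normal p-subgroup. *)

Require Import Defs.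
From HB Require Import structures.
From mathcomp Require Import all_boot all_order all_algebra all_fingroup.
From mathcomp Require Import pgroup.
From mathcomp Require Import boolp classical_sets reals topology normedtype.
From mathcomp Require Import cardinality.
From mathcomp Require Import lra ring.
Import Order.TTheory GRing.Theory Num.Theory.
Import numFieldNormedType.Exports.
Set Implicit Arguments.
Unset Strict Implicit.
Unset Printing Implicit Defensive.
Local Open Scope group_scope.
Local Open Scope classical_set_scope.
Local Open Scope ring_scope.

Section Topology.
Variables (R : realType) (V : finType).
Local Notation E := {ptws V -> R}.

Lemma continuous_eval (v : V) : continuous (fun x : E => x v).
Proof. exact: (@proj_continuous V (fun=> R) v). Qed.

Lemma continuous_into_ptws (U : topologicalType) (f : U -> E) :
  (forall v, continuous (fun z => f z v)) -> continuous f.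
Proof.
move=> cf z; apply/cvg_sup => v.
rewrite cvg_image; last by apply/seteqP; split=> // r _; exists (fun=> r).
move=> W /(cf v z) fW; exists (@^~ v @^-1` W) => //.
by apply/seteqP; split=> [r [? + <-//]|r Wr]; exists (fun=> r).
Qed.

Lemma continuous_cstT (U W : topologicalType) (c : W) : continuous (fun _ : U => c).
Proof. by move=> z; exact: cvg_cst. Qed.

Lemma continuous_add (U : topologicalType) (f g : U -> R) :
  continuous f -> continuous g -> continuous (fun z => f z + g z).
Proof. by move=> cf cg z; apply: cvgD; [exact: cf | exact: cg]. Qed.

Lemma continuous_opp (U : topologicalType) (f : U -> R) :
  continuous f -> continuous (fun z => - f z).
Proof. by move=> cf z; apply: cvgN; exact: cf. Qed.

Lemma continuous_mul (U : topologicalType) (f g : U -> R) :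
  continuous f -> continuous g -> continuous (fun z => f z * g z).
Proof. by move=> cf cg z; apply: cvgM; [exact: cf | exact: cg]. Qed.

Lemma continuous_inv (U : topologicalType) (f : U -> R) :
  (forall z, f z != 0) -> continuous f -> continuous (fun z => (f z)^-1).
Proof. by move=> f0 cf z; apply: cvgV; [exact: f0 | exact: cf]. Qed.

Lemma continuous_minr (U : topologicalType) (f g : U -> R) :
  continuous f -> continuous g -> continuous (fun z => Num.min (f z) (g z)).
Proof. by move=> cf cg z; apply: continuous_min; [exact: cf | exact: cg]. Qed.

Lemma continuous_maxr (U : topologicalType) (f g : U -> R) :
  continuous f -> continuous g -> continuous (fun z => Num.max (f z) (g z)).
Proof. by move=> cf cg z; apply: continuous_max; [exact: cf | exact: cg]. Qed.

Lemma continuous_sum (U : topologicalType) (I : Type) (r : seq I) (P : pred I)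
    (f : I -> U -> R) :
  (forall i, continuous (f i)) -> continuous (fun z => \sum_(i <- r | P i) f i z).
Proof.
move=> cf; elim: r => [|i r IHr].
  by under [X in continuous X]eq_fun do rewrite big_nil; exact: continuous_cstT.
under [X in continuous X]eq_fun do rewrite big_cons.
by case: (P i) => //; apply: continuous_add.
Qed.

Lemma continuous_bigmaxr (U : topologicalType) (I : Type) (r : seq I)
    (P : pred I) (f0 : U -> R) (f : I -> U -> R) :
  continuous f0 -> (forall i, continuous (f i)) ->
  continuous (fun z => \big[Num.max/f0 z]_(i <- r | P i) f i z).
Proof.
move=> cf0 cf; elim: r => [|i r IHr].
  by under [X in continuous X]eq_fun do rewrite big_nil.
under [X in continuous X]eq_fun do rewrite big_cons.
by case: (P i) => //; apply: continuous_maxr.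
Qed.

Lemma continuous_fst (U W : topologicalType) : continuous (@fst U W).
Proof. by move=> z; exact: cvg_fst. Qed.

Lemma continuous_snd (U W : topologicalType) : continuous (@snd U W).
Proof. by move=> z; exact: cvg_snd. Qed.

Lemma continuous_pairT (U W X : topologicalType) (f : U -> W) (g : U -> X) :
  continuous f -> continuous g -> continuous (fun z => (f z, g z)).
Proof. by move=> cf cg z; apply: cvg_pair; [exact: cf | exact: cg]. Qed.

Lemma continuous_compT (U W X : topologicalType) (f : U -> W) (g : W -> X) :
  continuous f -> continuous g -> continuous (fun z => g (f z)).
Proof. by move=> cf cg z; apply: continuous_comp; [exact: cf | exact: cg]. Qed.

Lemma closed_le_fun (U : topologicalType) (f g : U -> R) :
  continuous f -> continuous g -> closed [set z | f z <= g z].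
Proof.
move=> cf cg; have -> : [set z | f z <= g z] =
    (fun z => f z + - g z) @^-1` [set r | r <= 0].
  by apply/seteqP; split=> z /=; rewrite subr_le0.
apply: closed_comp (@closed_le _ 0) => z _.
by apply: continuous_add => //; apply: continuous_opp.
Qed.

Lemma closed_eq_fun (U : topologicalType) (f g : U -> R) :
  continuous f -> continuous g -> closed [set z | f z = g z].
Proof.
move=> cf cg; have -> : [set z | f z = g z] =
    [set z | f z <= g z] `&` [set z | g z <= f z].
  apply/seteqP; split=> [z /= ->//|z [/= fg gf]].
  by apply: le_anti; rewrite fg gf.
by apply: closedI; apply: closed_le_fun.
Qed.

Lemma closed_forall (U : topologicalType) (I : Type) (P : I -> set U) :
  (forall i, closed (P i)) -> closed [set z | forall i, P i z].
Proof.
move=> cP; have -> : [set z | forall i, P i z] = \bigcap_i P i.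
  by apply/seteqP; split=> z H i //; apply: H.
by apply: closed_bigI.
Qed.

Lemma closed_exists (U : topologicalType) (I : finType) (P : I -> set U) :
  (forall i, closed (P i)) -> closed [set z | exists i, P i z].
Proof.
move=> cP; have -> : [set z | exists i, P i z] = \bigcup_(i in [set: I]) P i.
  by apply/seteqP; split=> z [i]; [exists i | move=> _; exists i].
by apply: closed_bigcup => //; exact: finite_finset.
Qed.

Lemma within_compT (U W X : topologicalType) (A : set U) (B : set W)
    (f : U -> W) (g : W -> X) :
  (forall z, A z -> B (f z)) -> {within A, continuous f} ->
  {within B, continuous g} -> {within A, continuous (fun z => g (f z))}.
Proof.
move=> fAB /subspace_continuousP cf /subspace_continuousP cg.
apply/subspace_continuousP => z Az.
apply: (@cvg_comp _ _ _ f g _ (within B (nbhs (f z)))); last by apply: cg; auto.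
move=> S /= BS; have := cf z Az _ BS; rewrite /fmap /= !nbhs_simpl /=.
by rewrite /within /=; apply: filterS => y + Ay; apply => //; apply: fAB.
Qed.

Lemma within_pair (U W X : topologicalType) (A : set U) (f : U -> W) (g : U -> X) :
  {within A, continuous f} -> {within A, continuous g} ->
  {within A, continuous (fun z => (f z, g z))}.
Proof. by move=> cf cg z; apply: cvg_pair; [exact: cf | exact: cg]. Qed.

Lemma within_eq (U W : topologicalType) (A : set U) (f g : U -> W) :
  (forall z, A z -> f z = g z) ->
  {within A, continuous f} -> {within A, continuous g}.
Proof.
move=> fg; apply: subspace_eq_continuous => z; rewrite inE; exact: fg.
Qed.

Lemma within_finite_union (U W : topologicalType) (I : finType)
    (A : I -> set U) (f : U -> W) :
  (forall i, closed (A i)) -> (forall i, {within A i, continuous f}) ->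
  {within [set z | exists i, A i z], continuous f}.
Proof.
move=> cA cf.
suff H (r : seq I) : closed [set z | exists2 i, i \in r & A i z] /\
    {within [set z | exists2 i, i \in r & A i z], continuous f}.
  have [_] := H (enum I); apply: continuous_subspaceW => z [i Ai].
  by exists i; rewrite ?mem_enum.
elim: r => [|i r [cr fr]].
  have -> : [set z | exists2 i, i \in [::] & A i z] = set0.
    by apply/seteqP; split=> z // [].
  by split; [exact: closed0 | exact: continuous_subspace0].
have -> : [set z | exists2 j, j \in i :: r & A j z] =
    A i `|` [set z | exists2 j, j \in r & A j z].
  apply/seteqP; split=> [z [j]|z [Ai|[j jr Aj]]].
  - by rewrite inE => /orP[/eqP->|jr Aj]; [left | right; exists j].
  - by exists i; rewrite ?mem_head.
  - by exists j; rewrite // inE jr orbT.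
by split; [exact: closedU | exact: withinU_continuous].
Qed.

End Topology.

(** * Realizations and the action *)

Section Realization.
Variables (R : realType) (gT : finGroupType) (G : {group gT}) (V : finType).
Variable to : action G V.
Local Notation E := {ptws V -> R}.
Local Notation act := (@realization_act R gT G V to).
Implicit Types (x y : E) (s : {set V}) (D : {set {set V}}) (g : gT).

Definition support_of x : {set V} := [set v | x v != 0]%SET.

Definition cell s : set E :=
  [set x | [/\ forall v, 0 <= x v, \sum_v x v = 1
             & forall v, v \notin s -> x v = 0]].

Lemma act_mul x g h : g \in G -> h \in G -> act (act x g) h = act x (g * h)%g.
Proof.
move=> gG hG; apply: funext => v; rewrite /realization_act invMg.
by rewrite actMin ?groupV.
Qed.

Lemma act_one x : act x 1%g = x.
Proof. by apply: funext => v; rewrite /realization_act invg1 act1. Qed.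

Lemma act_invK x g : g \in G -> act (act x g^-1%g) g = x.
Proof. by move=> gG; rewrite act_mul ?groupV// mulVg act_one. Qed.

Lemma continuous_act g : continuous (fun x : E => act x g).
Proof. by apply: continuous_into_ptws => v; apply: continuous_eval. Qed.

Lemma imset_actE s g v : g \in G ->
  (v \in [set to u g | u in s]%SET) = (to v g^-1%g \in s).
Proof.
move=> gG; apply/imsetP/idP => [[u us ->]|vs].
  by rewrite actKin.
by exists (to v g^-1%g); rewrite // actKVin.
Qed.

Lemma support_act x g : g \in G ->
  support_of (act x g) = [set to v g | v in support_of x]%SET.
Proof. by move=> gG; apply/setP => v; rewrite imset_actE// !inE. Qed.

Lemma sum_act x g : g \in G -> \sum_v act x g v = \sum_v x v.
Proof.
move=> gG; rewrite [RHS](reindex (fun v => to v g^-1%g))//.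
by exists (fun v => to v g) => v _; [rewrite actKVin | rewrite actKin].
Qed.

Lemma support_neq0 x : \sum_v x v = 1 -> support_of x != finset.set0.
Proof.
move=> x1; apply/eqP => x0; move: x1; rewrite big1 => [/eqP|v _].
  by rewrite eq_sym oner_eq0.
by apply/eqP; move/setP/(_ v): x0; rewrite !inE => /negbFE.
Qed.

Lemma cell_support s x : cell s x -> support_of x \subset s.
Proof.
case=> _ _ xs; apply/fintype.subsetP => v; rewrite inE; apply: contraNT => /xs ->.
by rewrite eqxx.
Qed.

Lemma closed_cell s : closed (cell s).
Proof.
have -> : cell s = [set x | forall v, 0 <= x v] `&` ([set x | \sum_v x v = 1] `&`
    [set x | forall v, v \notin s -> x v = 0]).
  by apply/seteqP; split=> x; [case | case=> ? []].
apply: closedI; [|apply: closedI].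
- apply: closed_forall => v.
  apply: (@closed_le_fun R E (fun=> 0) (fun x => x v)) .
    exact: continuous_cstT.
  exact: continuous_eval.
- apply: (@closed_eq_fun R E (fun x => \sum_v x v) (fun=> 1)) .
    by apply: continuous_sum => v; exact: continuous_eval.
  exact: continuous_cstT.
- apply: (@closed_forall E V (fun v => [set x : E | v \notin s -> x v = 0])) => v.
  case: (boolP (v \in s)) => vs.
    by rewrite (_ : mkset _ = setT); [exact: closedT | apply/seteqP; split].
  rewrite (_ : mkset _ = [set x : E | x v = 0]).
    apply: (@closed_eq_fun R E (fun x => x v) (fun=> 0)).
      exact: continuous_eval.
    exact: continuous_cstT.
  by apply/seteqP; split=> x /=; auto.
Qed.

Section Complex.
Variable D : {set {set V}}.
Hypothesis cD : simplicial_complex D.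

Lemma cell_realization s x : s \in D -> cell s x -> realization D x.
Proof.
move=> sD xs; have [x0 x1 _] := xs; split=> //.
by apply: cD.2 (cell_support xs) (support_neq0 x1).
Qed.

Lemma realization_cell x : realization D x -> cell (support_of x) x.
Proof. by case=> x0 x1 xD; split=> // v; rewrite inE negbK => /eqP. Qed.

End Complex.

Section GComplex.
Variable D : {set {set V}}.
Hypothesis GD : G_simplicial_complex to D.

Lemma realization_stable x g : g \in G -> realization D x -> realization D (act x g).
Proof.
move=> gG [x0 x1 xD]; split=> [v||]; first exact: x0.
  by rewrite sum_act.
by rewrite -/(support_of _) support_act//; case: GD => _ + _; apply.
Qed.

Lemma act_fixed x g : g \in G -> (forall v, x v != 0 -> to v g = v) -> act x g = x.
Proof.
move=> gG fx; apply: funext => v; rewrite /realization_act.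
have [xu|] := eqVneq (x (to v g^-1%g)) 0; last first.
  by move/fx; rewrite actKVin// => <-.
rewrite xu; apply/esym/eqP/negPn/negP => xv.
have e : to v g^-1%g = v by rewrite -{1}(fx v xv) actKin.
by move: xv; rewrite -e xu eqxx.
Qed.

Lemma mem_stab s g : g \in G ->
  (g \in ('N_G(s | to))%g) = (setact to s g == s).
Proof.
move=> gG; rewrite finset.in_setI gG/=; apply/idP/eqP => [/astabs_setact//|sg].
rewrite !inE gG/=; apply/fintype.subsetP => v vs; rewrite inE -sg.
exact: imset_f.
Qed.

Lemma stab_fix s g v : s \in D -> g \in ('N_G(s | to))%g -> v \in s -> to v g = v.
Proof.
move=> sD gs vs; have [_ _ /(_ s sD) sGD] := GD.
have := fintype.subsetP sGD g gs; rewrite finset.in_setI => /andP[_].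
by move/astab_act; apply.
Qed.

Lemma cell_fixed s x g : s \in D -> g \in ('N_G(s | to))%g -> cell s x -> act x g = x.
Proof.
move=> sD gs xs; have gG : g \in G by move: gs; rewrite finset.in_setI => /andP[].
apply: act_fixed => // v xv; apply: (stab_fix sD gs).
by apply: fintype.subsetP (cell_support xs) _ _; rewrite inE.
Qed.

Lemma fixed_realizationE (H : {set gT}) x : H \subset G ->
  realization (fixed_subcomplex to D H) x <->
  realization D x /\ forall g, g \in H -> act x g = x.
Proof.
move=> HG; split=> [[x0 x1]|[[x0 x1 xD] xH]].
  rewrite inE => /andP[xD xH]; split=> // g gH.
  apply: act_fixed => [|v xv]; first exact: fintype.subsetP HG _ gH.
  by move/fintype.subsetP/(_ v): xH; rewrite inE => /(_ xv)/afixP; apply.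
split=> //; rewrite inE xD/=; apply/fintype.subsetP => v xv.
apply/afixP => g gH; have gG := fintype.subsetP HG g gH.
apply: stab_fix xD _ xv; rewrite mem_stab//; apply/eqP.
by rewrite setactE -[LHS](support_act _ gG) xH.
Qed.

End GComplex.
End Realization.

(** * Extending maps over a prism *)

Section Cone.
Variables (R : realType) (V : finType).
Local Notation E := {ptws V -> R}.
Local Notation unit_itv := (`[0%R, 1%R]%classic : set R).
Implicit Types (s : {set V}) (z : R * E) (Y : set E).

Lemma unit_itvE (t : R) : unit_itv t = (0 <= t <= 1) :> Prop.
Proof. by rewrite /= in_itv. Qed.

Definition contraction Y (c : E) (h : R * E -> E) :=
  [/\ Y c, {within unit_itv `*` Y, continuous h},
      forall t x, 0 <= t <= 1 -> Y x -> Y (h (t, x))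
    & forall x, Y x -> h (0, x) = x /\ h (1, x) = c].

Definition barycenter s (v : V) : R := if v \in s then #|s|%:R^-1 else 0.

(* The Minkowski gauge of the prism [`[0, 1] * cell s] about its centre
   [(1/2, barycenter s)]. *)
Definition gauge s z : R :=
  \big[Num.max/`|2 * z.1 - 1|]_(v in s) (1 - #|s|%:R * z.2 v).

(* Radial projection to the boundary, frozen where the gauge is below 1/2 so that
   it is continuous everywhere. *)
Definition push s z : R * E :=
  let r := Num.max (gauge s z) 2^-1 in
  (2^-1 + (z.1 - 2^-1) / r, fun v => barycenter s v + (z.2 v - barycenter s v) / r).

Definition prism s : set (R * E) := unit_itv `*` @cell R V s.

Definition prism_boundary s : set (R * E) :=
  [set z | prism s z /\ [\/ z.1 = 0, z.1 = 1 | exists2 v, v \in s & z.2 v = 0]].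

Lemma continuous_coord v : continuous (fun z : R * E => z.2 v).
Proof.
apply: (@continuous_compT (R * E)%type E R snd (fun x => x v)).
  exact: continuous_snd.
exact: continuous_eval.
Qed.

Lemma continuous_gauge s : continuous (gauge s).
Proof.
apply: continuous_bigmaxr => [|v].
  apply: (@continuous_compT (R * E)%type R R
    (fun z => 2 * z.1 - 1) (fun r : R => `|r|)); last exact: norm_continuous.
  apply: continuous_add; last exact: continuous_cstT.
  by apply: continuous_mul; [exact: continuous_cstT | exact: continuous_fst].
apply: continuous_add; first exact: continuous_cstT.
apply: continuous_opp; apply: continuous_mul; first exact: continuous_cstT.
exact: continuous_coord.
Qed.

Lemma continuous_push s : continuous (push s).
Proof.
have cr : continuous (fun z => (Num.max (gauge s z) 2^-1)^-1).
  apply: continuous_inv => [z|].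
    by rewrite gt_eqF// lt_max invr_gt0 ltr0n orbT.
  by apply: continuous_maxr; [exact: continuous_gauge | exact: continuous_cstT].
apply: continuous_pairT.
  apply: continuous_add; first exact: continuous_cstT.
  apply: continuous_mul cr; apply: continuous_add; last exact: continuous_cstT.
  exact: continuous_fst.
apply: continuous_into_ptws => v.
apply: continuous_add; first exact: continuous_cstT.
apply: continuous_mul cr; apply: continuous_add; last exact: continuous_cstT.
exact: continuous_coord.
Qed.

Lemma gauge_ge_time s z : `|2 * z.1 - 1| <= gauge s z.
Proof. exact: bigmax_ge_id. Qed.

Lemma gauge_ge_coord s z v : v \in s -> 1 - #|s|%:R * z.2 v <= gauge s z.
Proof. by move=> vs; apply: (le_bigmax_cond _ (fun v => 1 - #|s|%:R * z.2 v)). Qed.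

Lemma gauge_le1 s z : prism s z -> gauge s z <= 1.
Proof.
case; rewrite unit_itvE => t01 [x0 _ _]; apply/bigmax_leP; split=> [|v _].
  by rewrite ler_norml; lra.
by rewrite gerBl mulr_ge0.
Qed.

Lemma gauge_boundary s z : prism_boundary s z -> gauge s z = 1.
Proof.
case=> zs zb; apply: le_anti; rewrite gauge_le1//=; case: zb => [z0|z1|[v vs xv]].
- by apply: le_trans (gauge_ge_time s z); rewrite z0 mulr0 sub0r normrN normr1.
- apply: le_trans (gauge_ge_time s z); rewrite z1 mulr1.
  by rewrite (_ : 2 - 1 = 1 :> R) ?normr1//; lra.
- by apply: le_trans (gauge_ge_coord z vs); rewrite xv mulr0 subr0.
Qed.

Lemma push_id s z : gauge s z = 1 -> push s z = z.
Proof.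
case: z => t x g1; rewrite /push g1 max_l; last by lra.
rewrite invr1 /=; congr pair; first by rewrite mulr1 addrC subrK.
by apply: funext => v; rewrite mulr1 addrC subrK.
Qed.

Lemma sum_barycenter s : s != finset.set0 -> \sum_v barycenter s v = 1.
Proof.
move=> s0; rewrite -big_mkcond/= sumr_const -[LHS]mulr_natl mulfV//.
by rewrite pnatr_eq0 cards_eq0.
Qed.

Lemma push_boundary s z : s != finset.set0 -> prism s z -> 2^-1 <= gauge s z ->
  prism_boundary s (push s z).
Proof.
move=> s0 zs g2; have [] := zs; rewrite unit_itvE.
case: z zs g2 => t x zs g2 /= t01 [x0 x1 xs].
rewrite /push (max_l g2).
set r := gauge s (t, x) in g2 *.
have r0 : 0 < r by lra.
have n0 : #|s|%:R != 0 :> R by rewrite pnatr_eq0 cards_eq0.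
have tr : `|2 * t - 1| <= r := gauge_ge_time s (t, x).
have t01' : unit_itv (2^-1 + (t - 2^-1) / r).
  rewrite unit_itvE; move: tr; rewrite ler_norml => /andP[tr1 tr2].
  have H1 : - 2^-1 <= (t - 2^-1) / r by rewrite ler_pdivlMr//; lra.
  have H2 : (t - 2^-1) / r <= 2^-1 by rewrite ler_pdivrMr//; lra.
  by apply/andP; split; lra.
split; first (split=> //=; split).
- move=> v; rewrite /barycenter; case: ifPn => vs; last by rewrite xs// subr0 mul0r addr0.
  have := gauge_ge_coord (t, x) vs; rewrite /= -/r => xr.
  rewrite -[leLHS](@mul0r _ (#|s|%:R^-1)) -[leRHS](mulfK n0).
  rewrite ler_pM2r ?invr_gt0 ?ltr0n ?card_gt0//.
  have -> : (#|s|%:R^-1 + (x v - #|s|%:R^-1) / r) * #|s|%:R =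
      1 + (#|s|%:R * x v - 1) / r by field; rewrite n0 gt_eqF.
  have : -1 <= (#|s|%:R * x v - 1) / r by rewrite ler_pdivlMr//; lra.
  by lra.
- rewrite big_split/= sum_barycenter// -mulr_suml sumrB x1 sum_barycenter//.
  by rewrite subrr mul0r addr0.
- by move=> v vs; rewrite /barycenter (negbTE vs) xs// subr0 mul0r addr0.
have : r <= gauge s (t, x) by exact: lexx.
rewrite /gauge => /bigmax_geP[|[v vs]] /= rl.
  have {rl tr} : `|2 * t - 1| = r by apply: le_anti; rewrite tr rl.
  case: (ler0P (2 * t - 1)) => _ rE.
    constructor 1; have -> : t - 2^-1 = - (r / 2) by lra.
    by field; rewrite gt_eqF.
  constructor 2; have -> : t - 2^-1 = r / 2 by lra.
  by field; rewrite gt_eqF.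
have rE : 1 - #|s|%:R * x v = r.
  by apply: le_anti; rewrite rl (gauge_ge_coord (t, x) vs).
constructor 3; exists v => //=; rewrite /barycenter vs.
have -> : x v = (1 - r) / #|s|%:R by rewrite -rE; field.
by field; rewrite n0 gt_eqF.
Qed.

(* Cones off a map [f] given on the boundary of the prism by means of a
   contraction [h] of the target to [c]. *)
Definition cone s (c : E) (h f : R * E -> E) z : E :=
  if gauge s z <= 2^-1 then c else h (2 * (1 - gauge s z), f (push s z)).

Section ConeTheory.
Variables (s : {set V}) (Y : set E) (c : E) (h f : R * E -> E).
Hypotheses (s0 : s != finset.set0) (hY : contraction Y c h).
Hypothesis fY : forall z, prism_boundary s z -> Y (f z).

Lemma cone_boundary z : prism_boundary s z -> cone s c h f z = f z.
Proof.
move=> zb; have g1 := gauge_boundary zb; rewrite /cone g1 push_id// ifF; last first.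
  by apply/negbTE; rewrite -ltNge; lra.
by case: hY => _ _ _ /(_ _ (fY zb))[+ _]; rewrite subrr mulr0.
Qed.

Lemma cone_mem z : prism s z -> Y (cone s c h f z).
Proof.
case: hY => Yc _ Yh _ zs; rewrite /cone; case: ifPn => //; rewrite -ltNge => g2.
have g1 := gauge_le1 zs.
by apply: Yh; [apply/andP; split; lra | apply: fY; apply: push_boundary => //; lra].
Qed.

Lemma closed_prism : closed (prism s).
Proof.
have -> : prism s = [set z | 0 <= z.1] `&` ([set z | z.1 <= 1] `&` snd @^-1` cell s).
  apply/seteqP; split=> [[t x] []|[t x] [/= t0 [t1 xs]]].
    by rewrite unit_itvE => /andP[].
  by split=> //; rewrite unit_itvE /= t0.
apply: closedI; [|apply: closedI].
- apply: (@closed_le_fun R (R * E)%type (fun=> 0) fst).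
    exact: continuous_cstT.
  exact: continuous_fst.
- apply: (@closed_le_fun R (R * E)%type fst (fun=> 1)).
    exact: continuous_fst.
  exact: continuous_cstT.
- apply: (@closed_comp _ _ (fun z : R * E => z.2)) (@closed_cell R V s) => z _.
  exact: continuous_snd.
Qed.

Lemma within_cone : {within prism_boundary s, continuous f} ->
  {within prism s, continuous (cone s c h f)}.
Proof.
move=> cf; case: hY => Yc ch _ h01.
have -> : prism s = (prism s `&` [set z | gauge s z <= 2^-1]) `|`
                    (prism s `&` [set z | 2^-1 <= gauge s z]).
  apply/seteqP; split=> [z zs|z [[]|[]]//].
  by have [g2|/ltW g2] := leP (gauge s z) 2^-1; [left | right].
have cg := @continuous_gauge s.
apply: withinU_continuous.
- apply: closedI; first exact: closed_prism.
  by apply: (closed_le_fun cg); exact: continuous_cstT.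
- apply: closedI; first exact: closed_prism.
  by apply: (closed_le_fun _ cg); exact: continuous_cstT.
- apply: (@within_eq _ _ _ (fun=> c)) => [z [_ /= g2]|]; first by rewrite /cone g2.
  by apply: continuous_subspaceT; exact: continuous_cstT.
apply: (@within_eq _ _ _ (fun z => h (2 * (1 - gauge s z), f (push s z)))).
  move=> z [zs /= g2]; rewrite /cone; case: ifPn => // g2'.
  have -> : gauge s z = 2^-1 by apply: le_anti; rewrite g2 g2'.
  have -> : 2 * (1 - 2^-1) = 1 :> R by lra.
  exact: (h01 _ (fY (push_boundary s0 zs g2))).2.
apply: (@within_compT _ _ _ _ (unit_itv `*` Y) _ h) ch.
  move=> z [zs /= g2]; have g1 := gauge_le1 zs; split.
    by rewrite /= in_itv /=; apply/andP; split; lra.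
  exact: fY (push_boundary s0 zs g2).
apply: within_pair.
  apply: continuous_subspaceT; apply: continuous_mul; first exact: continuous_cstT.
  apply: continuous_add; first exact: continuous_cstT.
  exact: continuous_opp.
apply: (@within_compT _ _ _ _ (prism_boundary s) _ f) cf.
  by move=> z [zs /= g2]; exact: push_boundary.
by apply: continuous_subspaceT; exact: continuous_push.
Qed.

End ConeTheory.
End Cone.

(** * The equivariant homotopy *)

Section Whitehead.
Variables (R : realType) (gT : finGroupType) (G : {group gT}) (V : finType).
Variable to : action G V.
Local Notation E := {ptws V -> R}.
Local Notation act := (@realization_act R gT G V to).
Local Notation unit_itv := (`[0%R, 1%R]%classic : set R).
Implicit Types (x y : E) (s : {set V}) (g : gT).

Lemma card_setact_in s g : g \in G -> #|setact to s g| = #|s|.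
Proof.
by move=> gG; rewrite setactE card_in_imset// => u v _ _; apply: act_inj.
Qed.

Lemma gauge_act s t x g : g \in G ->
  gauge (setact to s g) (t, act x g) = gauge s (t, x).
Proof.
move=> gG; rewrite /gauge card_setact_in// setactE bigmax_imset.
by apply: eq_bigr => v _; rewrite /realization_act /= actKin.
Qed.

Lemma push_act s t x g : g \in G ->
  push (setact to s g) (t, act x g) =
  ((push s (t, x)).1, act (push s (t, x)).2 g).
Proof.
move=> gG; rewrite /push gauge_act//=; congr pair; apply: funext => v.
by rewrite /realization_act /barycenter card_setact_in// setactE imset_actE.
Qed.

Lemma cell_act s x g : g \in G -> cell s x -> cell (setact to s g) (act x g).
Proof.
move=> gG [x0 x1 xs]; split=> [v||v].
- exact: x0.
- by rewrite sum_act.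
- by rewrite setactE imset_actE// => /xs.
Qed.

Lemma setact_mul s g k : g \in G -> k \in G ->
  setact to s (g * k)%g = setact to (setact to s g) k.
Proof.
move=> gG kG; apply/setP => v; rewrite !setactE !imset_actE ?groupM//.
by rewrite invMg actMin ?groupV.
Qed.

Lemma setact_one s : setact to s 1%g = s.
Proof. by apply/setP => v; rewrite setactE imset_actE// invg1 act1. Qed.

Section Stabilizers.
Variable D : {set {set V}}.
Hypothesis GD : G_simplicial_complex to D.
Local Notation stab s := ('N_G(s | to))%g.
Local Notation fixed s := (realization (R := R) (fixed_subcomplex to D (stab s))).

Lemma fixedE s x : fixed s x <->
  realization D x /\ forall g, g \in stab s -> act x g = x.
Proof. by apply: fixed_realizationE => //; exact: finset.subsetIl. Qed.

Lemma stab_in s g : g \in stab s -> g \in G.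
Proof. by rewrite finset.in_setI => /andP[]. Qed.

Lemma fixed_act s x g : g \in G -> fixed s x -> fixed (setact to s g) (act x g).
Proof.
move=> gG /fixedE[xD xs]; apply/fixedE; split; first exact: realization_stable.
move=> a aS; have aG := stab_in aS.
have bS : (g * a * g^-1)%g \in stab s.
  rewrite mem_stab ?groupM ?groupV//; apply/eqP.
  move: aS; rewrite mem_stab// => /eqP sga.
  rewrite setact_mul ?groupM ?groupV// setact_mul// sga.
  by rewrite -setact_mul ?groupV// mulgV setact_one.
by rewrite act_mul// -[in RHS](xs _ bS) act_mul ?groupM ?groupV// mulgKV.
Qed.

Lemma cell_sub_fixed s x : s \in D -> cell s x -> fixed s x.
Proof.
move=> sD xs; apply/fixedE; split.
  by have [cD _ _] := GD; exact: (cell_realization cD sD xs).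
by move=> g gs; exact: (cell_fixed GD sD gs xs).
Qed.

Lemma setact_stable s g : g \in G -> s \in D -> setact to s g \in D.
Proof. by move=> gG sD; rewrite setactE; case: GD => _ + _; apply. Qed.

Definition orbit_repr s : {set V} :=
  odflt s [pick r | [exists g in G, setact to s g == r]].

Lemma orbit_reprP s : exists2 g, g \in G & setact to (orbit_repr s) g = s.
Proof.
rewrite /orbit_repr; case: pickP => [r /exists_inP[g gG /eqP <-]|_] /=.
  by exists g^-1%g; rewrite ?groupV// -setact_mul ?groupV// mulgV setact_one.
by exists 1%g; rewrite ?group1 ?setact_one.
Qed.

Lemma orbit_repr_act s g : g \in G -> orbit_repr (setact to s g) = orbit_repr s.
Proof.
move=> gG; have e : [pick r | [exists k in G, setact to (setact to s g) k == r]]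
                  = [pick r | [exists k in G, setact to s k == r]].
  apply: eq_pick => r /=; apply/idP/idP => /exists_inP[k kG /eqP <-]; apply/exists_inP.
    by exists (g * k)%g; rewrite ?groupM// setact_mul.
  by exists (g^-1 * k)%g; rewrite ?groupM ?groupV// -setact_mul ?groupM ?groupV// mulKVg.
rewrite /orbit_repr e; case: pickP => // /(_ s) /exists_inP[].
by exists 1%g; rewrite ?group1 ?setact_one.
Qed.

(* Contractions are chosen for one simplex in each orbit and transported along
   the action; the choice of the transporting element is harmless because the
   stabilizer of the representative acts trivially on its fixed points. *)
Lemma equivariant_contractions :
  (forall s, s \in D -> exists c h, contraction (fixed s) c h) ->
  exists c h, forall s, s \in D -> contraction (fixed s) (c s) (h s) /\
    forall g, g \in G -> c (setact to s g) = act (c s) g /\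
      forall t x, 0 <= t <= 1 -> fixed s x ->
        h (setact to s g) (t, act x g) = act (h s (t, x)) g.
Proof.
move=> H.
have /choice[ch chP] : forall s, exists ch : E * (R * E -> E),
    s \in D -> contraction (fixed s) ch.1 ch.2.
  move=> s; have [sD|sD] := boolP (s \in D); last by exists (fun=> 0, fun=> fun=> 0).
  by have [c [h hs]] := H s sD; exists (c, h).
have /choice[e eP] : forall s, exists a : gT,
    a \in G /\ setact to (orbit_repr s) a = s.
  by move=> s; have [g gG gs] := orbit_reprP s; exists g.
have eG s : e s \in G by case: (eP s).
have reprE s : setact to s (e s)^-1%g = orbit_repr s.
  by rewrite -{1}(eP s).2 -setact_mul ?groupV// mulgV setact_one.
have reprD s : s \in D -> orbit_repr s \in D.
  by move=> sD; rewrite -reprE setact_stable ?groupV.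
exists (fun s => act (ch (orbit_repr s)).1 (e s)).
exists (fun s z => act ((ch (orbit_repr s)).2 (z.1, act z.2 (e s)^-1%g)) (e s)).
move=> s sD; have [hc hcont hY h01] := chP _ (reprD s sD).
have toY x : fixed s x -> fixed (orbit_repr s) (act x (e s)^-1%g).
  by rewrite -reprE; apply: fixed_act; rewrite groupV.
have ofY x : fixed (orbit_repr s) x -> fixed s (act x (e s)).
  by rewrite -{2}(eP s).2; apply: fixed_act.
split.
  split.
  - exact: ofY.
  - apply: (@within_compT _ _ _ _ setT _ (fun x : E => act x (e s))) => //.
      apply: (@within_compT _ _ _ _ (unit_itv `*` fixed (orbit_repr s))
        (fun z : R * E => (z.1, act z.2 (e s)^-1%g)) (ch (orbit_repr s)).2) hcont.
        by move=> [t x] [/= t01 xs]; split=> //; apply: toY.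
      apply: within_pair; first by apply: continuous_subspaceT; exact: continuous_fst.
      apply: continuous_subspaceT.
      apply: (@continuous_compT (R * E)%type E E snd (fun x => act x (e s)^-1%g)).
        exact: continuous_snd.
      exact: continuous_act.
    by apply: continuous_subspaceT; exact: continuous_act.
  - by move=> t x t01 xs; apply: ofY; apply: hY => //; apply: toY.
  - by move=> x xs; have [/= -> ->] := h01 _ (toY _ xs); rewrite act_invK.
move=> g gG; rewrite orbit_repr_act//.
set r := orbit_repr s; pose k := (e s * g * (e (setact to s g))^-1)%g.
have kr : k \in stab r.
  rewrite mem_stab ?groupM ?groupV//; apply/eqP.
  rewrite setact_mul ?groupM ?groupV// setact_mul// (eP s).2 reprE.
  exact: orbit_repr_act.
have kfix y : fixed r y -> act y k = y by move/fixedE => -[_]; apply.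
have ek : (k * e (setact to s g) = e s * g)%g by rewrite /k mulgKV.
have kG := stab_in kr.
split.
  by rewrite act_mul// -ek -act_mul// kfix.
move=> t x t01 xs /=.
have -> : act (act x g) (e (setact to s g))^-1%g = act x (e s)^-1%g.
  rewrite -[RHS](kfix _ (toY _ xs)) !act_mul ?groupV//.
  by congr act; rewrite /k !mulgA mulVg mul1g.
rewrite [RHS]act_mul// -ek -[RHS]act_mul// kfix//.
by apply: hY => //; apply: toY.
Qed.

Definition skeleton n : set E :=
  [set x | realization D x /\ (#|support_of x| <= n)%N].

Definition skeletal_homotopy n (x0 : E) (F : R * E -> E) :=
  [/\ {within unit_itv `*` skeleton n, continuous F},
      forall t x, 0 <= t <= 1 -> skeleton n x -> realization D (F (t, x)),
      forall x, skeleton n x -> F (0, x) = x /\ F (1, x) = x0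
    & forall t x g, 0 <= t <= 1 -> skeleton n x -> g \in G ->
        F (t, act x g) = act (F (t, x)) g].

Section Step.
Variables (n : nat) (x0 : E) (F : R * E -> E).
Variables (c : {set V} -> E) (h : {set V} -> R * E -> E).
Hypothesis x0D : realization D x0.
Hypothesis x0G : forall g, g \in G -> act x0 g = x0.
Hypothesis FP : skeletal_homotopy n x0 F.
Hypothesis hP : forall s, s \in D -> contraction (fixed s) (c s) (h s) /\
  forall g, g \in G -> c (setact to s g) = act (c s) g /\
    forall t x, 0 <= t <= 1 -> fixed s x ->
      h (setact to s g) (t, act x g) = act (h s (t, x)) g.

Let ends z := if z.1 == 0 then z.2 else if z.1 == 1 then x0 else F z.

Let next z := let s := support_of z.2 in
  if (#|s| <= n)%N then F z else cone s (c s) (h s) ends z.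

Lemma D_neq0 s : s \in D -> s != finset.set0.
Proof. by move=> sD; apply: contraTneq sD => ->; case: GD => -[]. Qed.

Lemma support_in_D x : realization D x -> support_of x \in D.
Proof. by case. Qed.

Lemma prism_in t x s : prism s (t, x) -> 0 <= t <= 1 /\ cell s x.
Proof. by case; rewrite unit_itvE. Qed.

Lemma cell_skeleton s x v : s \in D -> #|s| = n.+1 -> cell s x ->
  v \in s -> x v = 0 -> skeleton n x.
Proof.
move=> sD sn xs vs xv; split; first by case/fixedE: (cell_sub_fixed sD xs).
rewrite -ltnS -sn; apply: proper_card; rewrite properE cell_support//=.
by apply/subsetPn; exists v; rewrite // inE xv eqxx.
Qed.

Lemma ends_skeleton t x : 0 <= t <= 1 -> skeleton n x -> ends (t, x) = F (t, x).
Proof.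
case: FP => _ _ F01 _ t01 xn; rewrite /ends /=.
have [F0 F1] := F01 _ xn.
by case: eqP => [->|_]; [rewrite F0 | case: eqP => [->|//]; rewrite F1].
Qed.

Lemma ends_cases s z : s \in D -> #|s| = n.+1 -> prism_boundary s z ->
  [\/ z.1 = 0 /\ ends z = z.2, z.1 = 1 /\ ends z = x0
    | skeleton n z.2 /\ ends z = F z].
Proof.
move=> sD sn [zs zb]; rewrite /ends; case: eqP => [|/eqP z0]; first by constructor 1.
case: eqP => [|/eqP z1]; first by constructor 2.
constructor 3; split=> //; case: zb => [/eqP|/eqP|[v vs xv]].
- by rewrite (negbTE z0).
- by rewrite (negbTE z1).
- case: z zs {z0 z1} xv => t x /prism_in[_ xs] /= xv.
  exact: cell_skeleton sD sn xs vs xv.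
Qed.

Lemma F_fixed s t x : s \in D -> 0 <= t <= 1 -> cell s x -> skeleton n x ->
  fixed s (F (t, x)).
Proof.
case: FP => _ FD _ Fact sD t01 xs xn; apply/fixedE; split; first exact: FD.
move=> g gs; have gG := stab_in gs.
by rewrite -Fact// (cell_fixed GD sD gs xs).
Qed.

Lemma ends_fixed s z : s \in D -> #|s| = n.+1 -> prism_boundary s z -> fixed s (ends z).
Proof.
move=> sD sn zb; have [zs _] := zb.
have := ends_cases sD sn zb; case: z zs {zb} => t x /prism_in[t01 xs] /=.
case=> -[? ->]; first exact: cell_sub_fixed.
  by apply/fixedE; split=> // g /stab_in; exact: x0G.
exact: F_fixed.
Qed.

Lemma ends_act s t x g : g \in G -> s \in D -> #|s| = n.+1 ->
  prism_boundary s (t, x) -> ends (t, act x g) = act (ends (t, x)) g.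
Proof.
case: FP => _ _ _ Fact gG sD sn xb; have [/prism_in[t01 xs] _] := xb.
have := ends_cases sD sn xb; rewrite /ends /=.
case: eqP => // t0; case: eqP => [_ _|t1]; first by rewrite x0G.
by case=> [[/t0]|[/t1]|[xn _]] //; apply: Fact.
Qed.

Lemma within_ends s : s \in D -> #|s| = n.+1 ->
  {within prism_boundary s, continuous ends}.
Proof.
move=> sD sn; case: FP => Fc _ F01 _.
pose B0 : set (R * E) := prism s `&` [set z | z.1 = 0].
pose B1 : set (R * E) := prism s `&` [set z | z.1 = 1].
pose B2 : set (R * E) := prism s `&` [set z | exists i : 'I_#|s|, z.2 (enum_val i) = 0].
have -> : prism_boundary s = B0 `|` (B1 `|` B2).
  apply/seteqP; split=> [z [zs [z0|z1|[v vs xv]]]|z [[zs z0]|[[zs z1]|[zs [i xi]]]]].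
  - by left.
  - by right; left.
  - right; right; split=> //; exists (enum_rank_in vs v).
    by rewrite /= enum_rankK_in.
  - by split=> //; constructor 1.
  - by split=> //; constructor 2.
  - by split=> //; constructor 3; exists (enum_val i) => //; exact: enum_valP.
have cB0 : closed B0.
  apply: closedI; first exact: closed_prism.
  apply: (@closed_eq_fun R (R * E)%type fst (fun=> 0)).
    exact: continuous_fst.
  exact: continuous_cstT.
have cB1 : closed B1.
  apply: closedI; first exact: closed_prism.
  apply: (@closed_eq_fun R (R * E)%type fst (fun=> 1)).
    exact: continuous_fst.
  exact: continuous_cstT.
have cB2 : closed B2.
  apply: closedI; first exact: closed_prism.
  apply: (@closed_exists (R * E)%type 'I_#|s|
    (fun i => [set z | z.2 (enum_val i) = 0])) => i.
  apply: (@closed_eq_fun R (R * E)%type (fun z => z.2 (enum_val i)) (fun=> 0)).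
    exact: continuous_coord.
  exact: continuous_cstT.
apply: withinU_continuous => //; first exact: closedU.
  apply: (@within_eq _ _ _ snd) => [z [_ /= z0]|]; first by rewrite /ends z0 eqxx.
  by apply: continuous_subspaceT; exact: continuous_snd.
apply: withinU_continuous => //.
  apply: (@within_eq _ _ _ (fun=> x0)) => [z [_ /= z1]|].
    by rewrite /ends z1 oner_eq0 eqxx.
  by apply: continuous_subspaceT; exact: continuous_cstT.
have B2s z : B2 z -> (unit_itv `*` skeleton n) z.
  case: z => t x [/prism_in[t01 xs] [i xi]]; split; first by rewrite unit_itvE.
  by apply: cell_skeleton sD sn xs _ xi; exact: enum_valP.
apply: (@within_eq _ _ _ F) => [[t x] /B2s[]|].
  by rewrite unit_itvE => t01 xn; rewrite ends_skeleton.
exact: continuous_subspaceW B2s Fc.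
Qed.

Lemma next_skeleton z : skeleton n z.2 -> next z = F z.
Proof. by case=> _ zn; rewrite /next zn. Qed.

Lemma next_cone s z : s \in D -> #|s| = n.+1 -> prism s z ->
  next z = cone s (c s) (h s) ends z.
Proof.
move=> sD sn zs; have s0 := D_neq0 sD.
have [supp_s|supp_s] := eqVneq (support_of z.2) s.
  by rewrite /next supp_s ifN// sn -ltnNge.
case: z zs supp_s => t x zs /= supp_s; have [t01 xs] := prism_in zs.
have /subsetPn[v vs] : ~~ (s \subset support_of x).
  by apply: contra supp_s => ssx; rewrite finset.eqEsubset cell_support.
rewrite inE negbK => /eqP xv.
have xb : prism_boundary s (t, x) by split=> //; constructor 3; exists v.
have xn := cell_skeleton sD sn xs vs xv.
have [hs _] := hP sD.
rewrite next_skeleton// (cone_boundary hs (fun z => @ends_fixed s z sD sn) xb).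
by rewrite ends_skeleton.
Qed.

Lemma skeletonS x : skeleton n.+1 x -> skeleton n x \/
  [/\ support_of x \in D, #|support_of x| = n.+1 & cell (support_of x) x].
Proof.
case=> xD; rewrite leq_eqVlt ltnS => /orP[/eqP xn|xn]; last by left.
by right; split=> //; [exact: support_in_D | exact: realization_cell xD].
Qed.

Lemma next_homotopy : skeletal_homotopy n.+1 x0 next.
Proof.
have [Fc FD F01 Fact] := FP; split.
- pose A s : set (R * E) := if (s \in D) && (#|s| <= n.+1)%N then prism s else set0.
  apply: (@continuous_subspaceW _ _ _ [set z | exists s, A s z]).
    case=> t x [t01 xn]; exists (support_of x); rewrite /A.
    case: xn => xD xn; rewrite support_in_D// xn; split=> //.
    exact: realization_cell xD.
  apply: within_finite_union => s; rewrite /A; case: ifP => [/andP[sD sn]|_].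
  + exact: closed_prism.
  + exact: closed0.
  + have [hs _] := hP sD.
    move: sn; rewrite leq_eqVlt ltnS => /orP[/eqP sn|sn].
      apply: (@within_eq _ _ _ (cone s (c s) (h s) ends)) => [z zs|].
        by rewrite (next_cone sD sn zs).
      apply: (within_cone (D_neq0 sD) hs) => [z|]; first exact: ends_fixed.
      exact: within_ends.
    have ps : prism s `<=` unit_itv `*` skeleton n.
      case=> t x [t01 xs]; split=> //; split.
        by have [cD _ _] := GD; exact: (cell_realization cD sD xs).
      exact: leq_trans (subset_leq_card (cell_support xs)) sn.
    apply: (@within_eq _ _ _ F) => [z /ps[_]|]; first by move/next_skeleton.
    exact: continuous_subspaceW ps Fc.
  + exact: continuous_subspace0.
- move=> t x t01 /skeletonS[xn|[sD sn xs]]; first by rewrite next_skeleton//; exact: FD.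
  have [hs _] := hP sD.
  have zs : prism (support_of x) (t, x) by split=> //; rewrite unit_itvE.
  rewrite (next_cone sD sn)//.
  have := cone_mem (D_neq0 sD) hs (fun z => @ends_fixed _ z sD sn) zs.
  by case/fixedE.
- move=> x /skeletonS[xn|[sD sn xs]]; first by rewrite !next_skeleton//; exact: F01.
  have [hs _] := hP sD.
  have zs t : 0 <= t <= 1 -> prism (support_of x) (t, x).
    by move=> t01; split=> //; rewrite unit_itvE.
  have z0 : prism (support_of x) (0, x) by apply: zs; rewrite lexx ler01.
  have z1 : prism (support_of x) (1, x) by apply: zs; rewrite lexx ler01.
  rewrite !(next_cone sD sn)// !(cone_boundary hs (fun z => @ends_fixed _ z sD sn)).
  + by rewrite /ends /= eqxx oner_eq0 eqxx.
  + by split=> //; constructor 2.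
  + by split=> //; constructor 1.
- move=> t x g t01 /skeletonS[xn|[sD sn xs]] gG.
    rewrite next_skeleton; first by rewrite next_skeleton//; exact: Fact.
    case: xn => xD xn; split; first exact: realization_stable.
    by rewrite support_act// -setactE card_setact_in.
  set s := support_of x in sD sn xs.
  have zs : prism s (t, x) by split=> //; rewrite unit_itvE.
  have [hs /(_ g gG)[cg hg]] := hP sD.
  have zsg : prism (setact to s g) (t, act x g).
    by split; [rewrite unit_itvE | exact: cell_act].
  rewrite (next_cone sD sn zs).
  rewrite (@next_cone (setact to s g)) ?card_setact_in ?setact_stable//.
  rewrite /cone gauge_act// push_act//; case: ifPn => // g2; rewrite -ltNge in g2.
  have pb : prism_boundary s (push s (t, x)).
    by apply: push_boundary => //; [exact: D_neq0 | exact: ltW].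
  have g1 := gauge_le1 zs.
  rewrite (@ends_act s) -?surjective_pairing// hg//; last exact: ends_fixed.
  by apply/andP; split; lra.
Qed.

End Step.

Lemma skeletal_homotopy_exists n (x0 : E) :
  realization D x0 -> (forall g, g \in G -> act x0 g = x0) ->
  (forall s, s \in D -> exists c h, contraction (fixed s) c h) ->
  exists F, skeletal_homotopy n x0 F.
Proof.
move=> x0D x0G /equivariant_contractions[c [h hP]].
elim: n => [|n [F FP]]; last by eexists; exact: next_homotopy FP hP.
have sk0 x : ~ skeleton 0 x.
  case=> xD; rewrite leqn0 cards_eq0; apply/negP; apply: support_neq0.
  by case: xD.
exists (fun=> x0); split; try by [move=> ? /sk0 | move=> ? ? _ /sk0 | move=> ? ? ? _ /sk0].
by apply: continuous_subspaceT; exact: continuous_cstT.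
Qed.

Lemma contractible_of_fixed_points (x0 : E) :
  realization D x0 -> (forall g, g \in G -> act x0 g = x0) ->
  (forall s, s \in D -> exists c h, contraction (fixed s) c h) ->
  contractible_complex R to G D.
Proof.
move=> x0D x0G H; have [F [Fc FD F01 Fact]] := skeletal_homotopy_exists #|V| x0D x0G H.
have sk : skeleton #|V| = realization D.
  by apply/seteqP; split=> [x []//|x xD]; split=> //; exact: max_card.
rewrite sk in Fc FD F01 Fact.
by exists x0, F; split.
Qed.

End Stabilizers.
End Whitehead.

(** * Conical contractions of order complexes *)

Section OrderComplex.
Variables (R : realType) (V : finType) (le : rel V).
Local Notation E := {ptws V -> R}.
Local Notation unit_itv := (`[0%R, 1%R]%classic : set R).
Implicit Types (x : E) (t : R) (u v w : V).

Definition order_complex (A : {set V}) : {set {set V}} :=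
  [set c : {set V} | [&& c != finset.set0, c \subset A
     & [forall u in c, forall v in c, le u v || le v u]]]%SET.

Lemma order_complexP (A c : {set V}) : reflect
  [/\ c != finset.set0, {in c, forall u, u \in A}
     & {in c &, forall u v, le u v || le v u}] (c \in order_complex A).
Proof.
rewrite inE; apply: (iffP and3P) => -[c0 cA cc]; split=> //.
- by move=> u uc; apply: fintype.subsetP cA u uc.
- by move=> u v uc vc; move/forall_inP: cc => /(_ u uc)/forall_inP; apply.
- by apply/fintype.subsetP => u; exact: cA.
- by apply/forall_inP => u uc; apply/forall_inP => v vc; exact: cc.
Qed.

Lemma order_complex_simplicial (A : {set V}) : simplicial_complex (order_complex A).
Proof.
split=> [|s t /order_complexP[_ sA sc] ts t0]; first by rewrite inE eqxx.
apply/order_complexP; split=> // [u ut|u v ut vt].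
  by apply: sA; apply: fintype.subsetP ts u ut.
by apply: sc; apply: fintype.subsetP ts _ _.
Qed.

Section Conical.
Variables (f : V -> V) (q : V) (A : {set V}).
Hypothesis refl_le : reflexive le.
Hypothesis anti_le : antisymmetric le.
Hypothesis trans_le : transitive le.
Hypothesis qA : q \in A.
Hypothesis fA : {in A, forall u, f u \in A}.
Hypothesis le_f : {in A, forall u, le u (f u)}.
Hypothesis q_le_f : {in A, forall u, le q (f u)}.
Hypothesis f_mono : {in A &, forall u v, le u v -> le (f u) (f v)}.

Let below v : pred V := fun u => (u != v) && le u v.

(* [x] is a mass distribution on a chain.  At time [t] its lower part, of mass
   [1 - t], stays in place and its upper part is moved by [f]; moving the whole
   chain linearly instead would leave the complex, as [f u] and [v] need not be
   comparable for [u < v]. *)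
Definition kept t x v : R :=
  Num.min (x v) (Num.max 0 (1 - t - \sum_(u | below v u) x u)).

Definition moved t x v : R := x v - kept t x v.

Definition push_up t x : E := fun v => kept t x v + \sum_(u | f u == v) moved t x u.

Definition dirac_at v : E := fun u => (u == v)%:R.

Definition conical_homotopy (z : R * E) : E := fun v =>
  (1 - Num.max (2 * z.1 - 1) 0) * push_up (Num.min (2 * z.1) 1) z.2 v
  + Num.max (2 * z.1 - 1) 0 * dirac_at q v.

Lemma continuous_conical : continuous conical_homotopy.
Proof.
have c2 : continuous (fun z : R * E => 2 * z.1).
  by apply: continuous_mul; [exact: continuous_cstT | exact: continuous_fst].
have cs : continuous (fun z : R * E => Num.max (2 * z.1 - 1) 0).
  apply: continuous_maxr; last exact: continuous_cstT.
  by apply: continuous_add => //; exact: continuous_cstT.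
have cr : continuous (fun z : R * E => Num.min (2 * z.1) 1).
  by apply: continuous_minr => //; exact: continuous_cstT.
have ck v : continuous (fun z : R * E => kept (Num.min (2 * z.1) 1) z.2 v).
  apply: continuous_minr; first exact: continuous_coord.
  apply: continuous_maxr; first exact: continuous_cstT.
  apply: continuous_add.
    apply: continuous_add; first exact: continuous_cstT.
    exact: continuous_opp.
  by apply: continuous_opp; apply: continuous_sum => u; exact: continuous_coord.
apply: continuous_into_ptws => v; apply: continuous_add; apply: continuous_mul => //.
- apply: continuous_add; first exact: continuous_cstT.
  exact: continuous_opp.
- apply: continuous_add => //; apply: continuous_sum => u.
  apply: continuous_add; first exact: continuous_coord.
  exact: continuous_opp.
- exact: continuous_cstT.
Qed.

Lemma kept_ge0 t x v : (forall u, 0 <= x u) -> 0 <= kept t x v.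
Proof. by move=> x0; rewrite /kept le_min x0 le_max lexx. Qed.

Lemma moved_ge0 t x v : 0 <= moved t x v.
Proof. by rewrite subr_ge0 /kept ge_min lexx. Qed.

Lemma kept_support t x v : (forall u, 0 <= x u) -> kept t x v != 0 -> x v != 0.
Proof.
move=> x0; apply: contraNneq => xv; rewrite /kept xv min_l//.
by rewrite le_max lexx.
Qed.

Lemma moved_support t x v : (forall u, 0 <= x u) -> moved t x v != 0 -> x v != 0.
Proof.
move=> x0; apply: contraNneq => xv; rewrite /moved xv sub0r oppr_eq0 /kept xv.
by rewrite min_l// le_max lexx.
Qed.

Lemma kept1 x v : (forall u, 0 <= x u) -> kept 1 x v = 0.
Proof.
move=> x0; rewrite /kept (max_l (x := 0)); first by rewrite min_r.
by rewrite subrr sub0r oppr_le0 sumr_ge0.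
Qed.

Lemma kept0 x v : (forall u, 0 <= x u) -> \sum_u x u = 1 -> kept 0 x v = x v.
Proof.
move=> x0 x1; rewrite /kept min_l// le_max; apply/orP; right.
rewrite subr0 lerBrDr -x1 [leRHS](bigD1 v)//= lerD2l.
rewrite big_mkcond [leRHS]big_mkcond/=; apply: ler_sum => u _; rewrite /below.
by case: (u != v) => //=; case: ifP.
Qed.

Lemma kept_moved_le t x u w : (forall u, 0 <= x u) -> le u w || le w u ->
  kept t x u != 0 -> moved t x w != 0 -> le u w.
Proof.
move=> x0; case/orP=> // wu ku mw; have [<-//|wNu] := eqVneq w u.
have {}ku : \sum_(v | below u v) x v < 1 - t.
  rewrite ltNge; apply: contraNN ku => H.
  by rewrite /kept (max_l (x := 0)) ?min_r// subr_le0.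
have {}mw : 1 - t < x w + \sum_(v | below w v) x v.
  rewrite ltNge; apply: contraNN mw => H.
  by rewrite /moved /kept min_l ?subrr// le_max lerBrDr H orbT.
have : x w + \sum_(v | below w v) x v <= \sum_(v | below u v) x v.
  rewrite [leRHS](bigD1 w)/= ?lerD2l; last by rewrite /below wNu.
  rewrite big_mkcond [leRHS]big_mkcond/=; apply: ler_sum => v _.
  case: ifP => [/andP[vw lvw]|_]; last by case: ifP.
  rewrite ifT// vw andbT /below (trans_le lvw wu) andbT.
  apply: contraNneq vw => vu; apply/eqP/anti_le; rewrite lvw vu.
  by rewrite wu.
lra.
Qed.

Lemma sum_push_up t x : \sum_v push_up t x v = \sum_v x v.
Proof.
rewrite big_split/= [X in _ + X](_ : _ = \sum_u moved t x u); last first.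
  by rewrite [RHS](partition_big f xpredT).
rewrite -big_split/=.
by apply: eq_bigr => v _; rewrite addrC subrK.
Qed.

Lemma sum_dirac v : \sum_u dirac_at v u = 1.
Proof. by rewrite (bigD1 v)//= /dirac_at eqxx big1 ?addr0// => u /negbTE ->. Qed.

Lemma dirac_realization : realization (order_complex A) (dirac_at q).
Proof.
split=> [v||]; first exact: ler0n.
  exact: sum_dirac.
apply/order_complexP; split.
- by apply/set0Pn; exists q; rewrite inE /dirac_at eqxx oner_eq0.
- by move=> u; rewrite inE pnatr_eq0 eqb0 negbK => /eqP ->.
- move=> u v; rewrite !inE !pnatr_eq0 !eqb0 !negbK => /eqP -> /eqP ->.
  by rewrite refl_le.
Qed.

Lemma conical_realization t x : 0 <= t <= 1 ->
  realization (order_complex A) x ->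
  realization (order_complex A) (conical_homotopy (t, x)).
Proof.
move=> t01 [x0 x1 /order_complexP[_ xA xc]].
rewrite /conical_homotopy /=; set s := Num.max _ _; set r := Num.min _ _.
have s0 : 0 <= s by rewrite le_max lexx orbT.
have s1 : s <= 1 by rewrite /s ge_max; apply/andP; split; lra.
have sr : s != 0 -> r = 1.
  rewrite /s /r; case: (leP (2 * t - 1) 0) => [|H _]; first by rewrite eqxx.
  by rewrite min_r//; lra.
pose y : E := fun v => (1 - s) * push_up r x v + s * dirac_at q v.
have y1 : \sum_v y v = 1.
  by rewrite big_split/= -!mulr_sumr sum_push_up sum_dirac x1; ring.
have xAc v : x v != 0 -> v \in A by move=> xv; apply: xA; rewrite inE.
have y_cases v : y v != 0 -> [\/ kept r x v != 0,
    exists2 u, v = f u & moved r x u != 0 | s != 0 /\ v = q].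
  move=> yv; have [k0|] := eqVneq (kept r x v) 0; last by constructor 1.
  have [/existsP[u /andP[/eqP <- mu]]|/existsPn m0] :=
      boolP [exists u, (f u == v) && (moved r x u != 0)].
    by constructor 2; exists u.
  constructor 3; move: yv; rewrite /y /push_up k0 add0r big1 ?mulr0 ?add0r.
    rewrite mulf_eq0 negb_or => /andP[sn0]; rewrite /dirac_at pnatr_eq0 eqb0 negbK.
    by move/eqP.
  by move=> u fu; have := m0 u; rewrite fu negbK => /eqP.
have kA v : kept r x v != 0 -> x v != 0 by exact: kept_support.
have mA v : moved r x v != 0 -> x v != 0 by exact: moved_support.
have chain u v : x u != 0 -> x v != 0 -> le u v || le v u.
  by move=> xu xv; apply: xc; rewrite inE.
have sk v : s != 0 -> kept r x v = 0 by move/sr ->; exact: kept1.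
split=> // [v|].
  rewrite addr_ge0// mulr_ge0 ?subr_ge0 ?ler0n//.
  by rewrite addr_ge0 ?kept_ge0// sumr_ge0// => u _; exact: moved_ge0.
apply/order_complexP; split.
- exact: (support_neq0 y1).
- move=> v; rewrite inE => /y_cases[/kA/xAc//|[u -> /mA/xAc uA]|[_ ->]//].
  exact: fA.
move=> u v; rewrite !inE => /y_cases yu /y_cases yv.
case: yu yv => [ku|[u' -> mu]|[sn0 ->]] [kv|[v' -> mv]|[sn0' ->]].
- by apply: chain; apply: kA.
- have uv := kept_moved_le x0 (chain _ _ (kA _ ku) (mA _ mv)) ku mv.
  by rewrite (trans_le uv (le_f (xAc _ (mA _ mv)))).
- by rewrite (sk u sn0') eqxx in ku.
- have vu := kept_moved_le x0 (chain _ _ (kA _ kv) (mA _ mu)) kv mu.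
  by rewrite (trans_le vu (le_f (xAc _ (mA _ mu)))) orbT.
- have u'A := xAc _ (mA _ mu); have v'A := xAc _ (mA _ mv).
  by case/orP: (chain _ _ (mA _ mu) (mA _ mv)) => /f_mono -> //; rewrite orbT.
- by rewrite (q_le_f (xAc _ (mA _ mu))) orbT.
- by rewrite (sk v sn0) eqxx in kv.
- by rewrite (q_le_f (xAc _ (mA _ mv))).
- by rewrite refl_le.
Qed.

Lemma conical0 x : (forall v, 0 <= x v) -> \sum_v x v = 1 -> conical_homotopy (0, x) = x.
Proof.
move=> x0 x1; apply: funext => v; rewrite /conical_homotopy /= mulr0.
rewrite max_r ?sub0r ?lerN10// min_l ?ler01// subr0 mul1r mul0r addr0 /push_up kept0//.
by rewrite big1 ?addr0// => u _; rewrite /moved kept0// subrr.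
Qed.

Lemma conical1 x : conical_homotopy (1, x) = dirac_at q.
Proof.
apply: funext => v; rewrite /conical_homotopy /= mulr1.
have -> : Num.max (2 - 1) 0 = 1 :> R by rewrite max_l; lra.
by rewrite subrr mul0r add0r mul1r.
Qed.

Section Equivariance.
Variables (gT : finGroupType) (G : {group gT}) (to : action G V) (g : gT).
Hypothesis gG : g \in G.
Hypothesis le_act : forall u v, le (to u g) (to v g) = le u v.
Hypothesis f_act : forall u, f (to u g) = to (f u) g.
Hypothesis q_act : to q g = q.
Local Notation act := (@realization_act R gT G V to).

Lemma kept_act t x v : kept t (act x g) (to v g) = kept t x v.
Proof.
rewrite /kept /realization_act actKin//.
rewrite (reindex_inj (act_inj to g))/=; congr (Num.min _ (Num.max 0 (_ - _))).
by apply: eq_big => u; [rewrite /below le_act (inj_eq (act_inj to g)) | rewrite actKin].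
Qed.

Lemma dirac_act : act (dirac_at q) g = dirac_at q.
Proof.
apply: funext => v; rewrite /realization_act /dirac_at; congr (nat_of_bool _)%:R.
by apply/eqP/eqP => [vq|->]; [rewrite -(actKVin to gG v) vq | rewrite -{1}q_act actKin].
Qed.

Lemma conical_act t x : conical_homotopy (t, act x g) = act (conical_homotopy (t, x)) g.
Proof.
apply: funext => w; rewrite -(actKVin to gG w); set v := to w g^-1%g.
rewrite {2}/realization_act actKin// /conical_homotopy /=.
have -> : dirac_at q (to v g) = dirac_at q v.
  by rewrite -{1}dirac_act /realization_act actKin.
congr (_ * _ + _); rewrite /push_up kept_act; congr (_ + _).
rewrite (reindex_inj (act_inj to g))/=; apply: eq_big => u.
  by rewrite f_act (inj_eq (act_inj to g)).
by move=> _; rewrite /moved kept_act /realization_act actKin.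
Qed.

End Equivariance.

Lemma order_complex_contractible (gT : finGroupType) (G : {group gT})
    (to : action G V) (K : {set gT}) : K \subset G ->
  (forall g u v, g \in K -> le (to u g) (to v g) = le u v) ->
  (forall g u, g \in K -> f (to u g) = to (f u) g) ->
  (forall g, g \in K -> to q g = q) ->
  contractible_complex R to K (order_complex A).
Proof.
move=> KG leK fK qK.
exists (dirac_at q), conical_homotopy; split.
- split=> [|g gK]; first exact: dirac_realization.
  by apply: dirac_act; [exact: fintype.subsetP KG g gK | exact: qK].
- by apply: continuous_subspaceT; exact: continuous_conical.
- by move=> t x; exact: conical_realization.
- by move=> x [x0 x1 _]; split; [exact: conical0 | exact: conical1].
- move=> t x g _ _ gK; apply: conical_act.
  + exact: fintype.subsetP KG g gK.
  + by move=> u v; exact: leK.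
  + by move=> u; exact: fK.
  + exact: qK.
Qed.

End Conical.
End OrderComplex.

(** * Synthetic buildings *)

Section SyntheticBuildings.
Variables (R : realType) (gT : finGroupType) (G : {group gT}) (p : nat).
Implicit Types (P Q M : {group gT}) (g : gT).

Lemma contractible_complexS (V : finType) (to : action G V) (K L : {set gT}) D :
  K \subset L -> contractible_complex R to L D -> contractible_complex R to K D.
Proof.
move=> KL [x0 [h [[x0D x0L] hc hD h01 hL]]]; have KLg g gK := fintype.subsetP KL g gK.
exists x0, h; split=> //; first by split=> // g /KLg; exact: x0L.
by move=> t x g t01 xD /KLg; exact: hL.
Qed.

Lemma contractible_contraction (V : finType) (to : action G V) (K : {set gT}) D :
  contractible_complex R to K D -> exists c h, contraction (@realization R V D) c h.
Proof. by case=> x0 [h [[x0D _] hc hD h01 _]]; exists x0, h; split. Qed.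

Lemma fixed_synthetic (V : finType) (to : action G V) D Q :
  Q <| G -> p.-group Q -> Q :!=: 1%g ->
  synthetic_building R p to D -> synthetic_building R p to (fixed_subcomplex to D Q).
Proof.
move=> /andP[QG nQG] pQ Q1 [[[D0 Dsub] Dact Dstab] Dcontr Ddiv].
have FD (s : {set V}) : s \in fixed_subcomplex to D Q -> s \in D by rewrite inE => /andP[].
split.
- split; [split|..].
  + by rewrite inE negb_and D0.
  + move=> s t; rewrite !inE => /andP[sD sQ] ts t0.
    by rewrite (Dsub s)//=; apply: fintype.subset_trans ts sQ.
  + move=> g s gG; rewrite !inE => /andP[sD sQ]; rewrite Dact//=.
    apply/fintype.subsetP => _ /imsetP[v vs ->]; apply/afixP => a aQ.
    have aG : a \in G := fintype.subsetP QG a aQ.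
    have gaQ : (a ^ g^-1)%g \in Q by rewrite memJ_norm// groupV (fintype.subsetP nQG).
    have /afixP/(_ _ gaQ) {2}<- := fintype.subsetP sQ v vs.
    by rewrite -!actMin ?groupM ?groupV// conjgE invgK !mulgA mulgKV.
  + by move=> s /FD; exact: Dstab.
- move=> P PG pP P1.
  have PQ : fixed_subcomplex to (fixed_subcomplex to D Q) P =
            fixed_subcomplex to D (P <*> Q)%G.
    apply/setP => s; rewrite !inE -andbA; congr (_ && _).
    apply/andP/fintype.subsetP => [[/fintype.subsetP sQ /fintype.subsetP sP] v vs|H].
      have : (P <*> Q)%G \subset 'C_G[v | to]%g.
        rewrite join_subG; apply/andP; split; apply/fintype.subsetP => a aH.
          have aG : a \in G := fintype.subsetP PG a aH.
          by rewrite !inE aG/= finset.sub1set inE; move/afixP: (sP v vs) => ->.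
        have aG : a \in G := fintype.subsetP QG a aH.
        by rewrite !inE aG/= finset.sub1set inE; move/afixP: (sQ v vs) => ->.
      move/fintype.subsetP => H; apply/afixP => a /H.
      by rewrite finset.in_setI => /andP[_ /astab_act]; apply; rewrite finset.set11.
    split; apply/fintype.subsetP => v /H /afixP vPQ; apply/afixP => a aP.
      by apply: vPQ; apply: fintype.subsetP (joing_subr P Q) a aP.
    by apply: vPQ; apply: fintype.subsetP (joing_subl P Q) a aP.
  have nQP : P \subset 'N(Q)%g := fintype.subset_trans PG nQG.
  rewrite PQ; apply: (@contractible_complexS _ _ _ 'N_G(P <*> Q)%g).
    rewrite finset.subsetI finset.subsetIl normsY//; first exact: finset.subsetIr.
    exact: fintype.subset_trans (finset.subsetIl _ _) nQG.
  apply: Dcontr.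
  + by rewrite join_subG PG.
  + by rewrite /= norm_joinEl// pgroupM pP.
  + by apply: contraNneq Q1 => /= PQ1; rewrite -subG1 -PQ1 joing_subr.
- move=> s; rewrite inE => /andP[sD /fintype.subsetP sQ].
  have [_ pQdvd _] := pgroup_pdiv pQ Q1.
  apply: dvdn_trans pQdvd (cardSg _); apply/fintype.subsetP => a aQ.
  have aG : a \in G := fintype.subsetP QG a aQ.
  rewrite mem_stab// setactE; apply/eqP/setP => v; rewrite imset_actE//.
  apply/idP/idP => vs.
    by move/afixP: (sQ _ vs) => /(_ a aQ); rewrite actKVin// => ->.
  have /afixP/(_ a^-1%g) -> // := sQ v vs; exact: groupVr.
Qed.


Definition conj_action : action G {group gT} :=
  ract 'JG (finset.subsetT G : (G : {set gT}) \subset [set: gT]%SET).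

Definition group_le : rel {group gT} := fun P M => P \subset M.

Definition nontrivial_pgroups : {set {group gT}} :=
  [set P : {group gT} | [&& P \subset G, p.-group P & P :!=: 1%g]]%SET.

Definition brown_complex : {set {set {group gT}}} :=
  order_complex group_le nontrivial_pgroups.

Lemma fixed_group_norm (Q P : {group gT}) :
  (P \in 'Fix_conj_action(Q)) = (Q \subset 'N(P)).
Proof.
apply/afixP/fintype.subsetP => [H a /H|H a /H/normP PQ].
  by move/(congr1 val) => /= PQ; apply/normP.
by apply: val_inj.
Qed.

Lemma pgroup_join Q P : Q \in nontrivial_pgroups -> P \in nontrivial_pgroups ->
  Q \subset 'N(P) -> (P <*> Q)%G \in nontrivial_pgroups.
Proof.
rewrite !inE => /and3P[QG pQ Q1] /and3P[PG pP _] nPQ; apply/and3P; split.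
- by rewrite join_subG PG.
- by rewrite /= norm_joinEr// pgroupM pP.
- by apply: contraNneq Q1 => /= PQ1; rewrite -subG1 -PQ1 joing_subr.
Qed.

Lemma brown_fixed Q :
  fixed_subcomplex conj_action brown_complex Q =
  order_complex group_le (nontrivial_pgroups :&: 'Fix_conj_action(Q))%SET.
Proof.
apply/setP => c; rewrite !inE finset.subsetI.
by case: (c != finset.set0); case: (c \subset nontrivial_pgroups);
  case: (c \subset 'Fix_conj_action(Q)); rewrite /= ?andbT ?andbF.
Qed.

Lemma brown_G_complex : G_simplicial_complex conj_action brown_complex.
Proof.
split; first exact: order_complex_simplicial.
- move=> g s gG /order_complexP[s0 sA sc]; apply/order_complexP; split.
  + have /set0Pn[P Ps] := s0; apply/set0Pn; exists (conj_action P g); exact: imset_f.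
  + move=> _ /imsetP[P Ps ->]; have := sA P Ps; rewrite !inE /= => /and3P[PG pP P1].
    rewrite pgroupJ pP -(conjGid gG) conjSg PG/=.
    by rewrite -subG1 -(conjs1g g) conjSg subG1.
  + by move=> _ _ /imsetP[P Ps ->] /imsetP[M Ms ->]; rewrite /group_le !conjSg; exact: sc.
- move=> s /order_complexP[_ _ sc]; apply/fintype.subsetP => g.
  move=> gNs; have gG := fintype.subsetP (finset.subsetIl _ _) g gNs.
  have gs : g \in 'N(s | conj_action) := fintype.subsetP (finset.subsetIr _ _) g gNs.
  rewrite finset.in_setI gG/= !inE gG/=; apply/fintype.subsetP => P Ps; rewrite inE.
  have Pgs : conj_action P g \in s by rewrite (astabs_act _ gs).
  have Pg_sub : P :^ g = P.
    case/orP: (sc _ _ Ps Pgs) => PPg; last first.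
      by apply/eqP; rewrite eqEcard cardJg leqnn andbT.
    by apply/esym/eqP; rewrite eqEcard cardJg leqnn andbT.
  by apply/eqP/val_inj.
Qed.

Lemma brown_synthetic : synthetic_building R p conj_action brown_complex.
Proof.
split; first exact: brown_G_complex.
- move=> Q QG pQ Q1; rewrite brown_fixed.
  have QA : Q \in nontrivial_pgroups by rewrite inE QG pQ.
  apply: (@order_complex_contractible R _ group_le (fun P => (P <*> Q)%G) Q).
  + by move=> P; exact: fintype.subxx.
  + by move=> P M PM; apply/val_inj/eqP; rewrite finset.eqEsubset.
  + by move=> P M L; exact: fintype.subset_trans.
  + by rewrite finset.in_setI QA fixed_group_norm normG.
  + move=> P; rewrite !finset.in_setI !fixed_group_norm => /andP[PA nPQ].
    rewrite pgroup_join//=; apply: fintype.subset_trans (joing_subr P Q) _.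
    exact: normG.
  + by move=> P _; exact: joing_subl.
  + by move=> P _; exact: joing_subr.
  + by move=> P M _ _ PM; rewrite /group_le /= genS// finset.setSU.
  + exact: finset.subsetIl.
  + by move=> g P M _; rewrite /group_le conjSg.
  + move=> g P; rewrite finset.in_setI => /andP[_ /normP gQ].
    by apply/val_inj; rewrite /= conjYg gQ.
  + move=> g; rewrite finset.in_setI => /andP[_ /normP gQ].
    exact/val_inj.
- move=> s /order_complexP[/set0Pn[P0 P0s] sA sc].
  case: (arg_minnP (fun P : {group gT} => #|P|) P0s) => P Ps Pmin.
  have := sA P Ps; rewrite inE => /and3P[PG pP P1].
  have [_ pPdvd _] := pgroup_pdiv pP P1.
  apply: dvdn_trans pPdvd (cardSg _).
  have Ple M : M \in s -> P \subset M.
    move=> Ms; have /orP[//|MP] := sc _ _ Ps Ms.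
    have -> : P = M; last exact: fintype.subxx.
    apply/val_inj/eqP; rewrite eq_sym eqEcard Pmin// andbT; exact: MP.
  apply/fintype.subsetP => g gP; have gG := fintype.subsetP PG g gP.
  rewrite finset.in_setI gG/= !inE gG/=; apply/fintype.subsetP => M Ms.
  have Mg : (M :^ g)%G = M.
    by apply/val_inj; rewrite /= conjGid// (fintype.subsetP (Ple M Ms)).
  by rewrite inE /= Mg.
Qed.

Lemma pcore_of_fixed_point (D : {set {set {group gT}}}) x :
  D \subset brown_complex -> G_simplicial_complex conj_action D ->
  realization (R := R) D x ->
  (forall g, g \in G -> realization_act conj_action x g = x) -> 'O_p(G) != 1%g :> {set gT}.
Proof.
move=> DB GD xD xG; have [_ x1 sD] := xD.
have /set0Pn[P Ps] := support_neq0 x1.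
have /order_complexP[_ sA _] := fintype.subsetP DB _ sD.
have := sA P Ps; rewrite inE => /and3P[PG pP P1].
have nPG : P <| G.
  rewrite /normal PG; apply/fintype.subsetP => g gG; apply/normP.
  have gs : g \in 'N_G(support_of x | conj_action).
    by rewrite mem_stab// setactE -support_act// xG.
  by have /(congr1 val) := stab_fix GD sD gs Ps.
apply: contraNneq P1 => Op1; rewrite -subG1 -Op1; exact: pcore_max.
Qed.

End SyntheticBuildings.

Theorem theorem4p2 (R : realType) (gT : finGroupType) (G : {group gT})
    (p : nat) (hp : prime p) :
  ((p.-group G)%g -> G :!=: 1%g ->
    forall (V : finType) (to : action G V) (D : {set {set V}}),
      synthetic_building R p to D ->
      contractible_complex R to G D)
  /\
  ('O_p(G)%g :!=: 1%g <->
    forall (V : finType) (to : action G V) (D : {set {set V}}),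
      minimal_synthetic_building R p to D ->
      contractible_complex R to G D).
Proof.
split; [|split].
- move=> pG G1 V to D [GD Dcontr Ddiv].
  have [x0 [_ [[x0D x0G] _ _ _ _]]] := Dcontr G (fintype.subxx _) pG G1.
  apply: (contractible_of_fixed_points GD (x0 := x0)).
  + by case/(fixed_realizationE GD _ (fintype.subxx _)): x0D.
  + by move=> g gG; apply: x0G; rewrite finset.in_setI gG (fintype.subsetP (normG G)).
  + move=> s sD; apply: contractible_contraction; apply: Dcontr.
    * exact: finset.subsetIl.
    * exact: pgroupS (finset.subsetIl _ _) pG.
    * apply: contraL (Ddiv s sD) => /eqP ->.
      by rewrite cards1 gtnNdvd// prime_gt1.
- move=> Op1 V to D [DB Dmin].
  have nO : ('O_p(G) <| G)%g by exact: pcore_normal.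
  have DO := fixed_synthetic nO (pcore_pgroup p G) Op1 DB.
  have sub : fixed_subcomplex to D 'O_p(G) \subset D.
    by apply/fintype.subsetP => s; rewrite inE => /andP[].
  rewrite -(Dmin _ sub DO); have [_ Dcontr _] := DB.
  apply: contractible_complexS (Dcontr _ (pcore_sub p G) (pcore_pgroup p G) Op1).
  by rewrite finset.subsetI fintype.subxx normal_norm.
- move=> H; have B := asboolT (brown_synthetic R G p).
  have [D /minsetP[/asboolP DB Dmin] sub] :=
    minset_exists (P := fun D => `[< synthetic_building R p (conj_action G) D >]) B.
  have [|x0 [_ [[x0D x0G] _ _ _ _]]] := H _ (conj_action G) D.
    by split=> // D' D'D /asboolT D'B; exact: Dmin.
  by have [GD _ _] := DB; exact: pcore_of_fixed_point sub GD x0D x0G.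
Qed.
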